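(* Let $A\in\mathbb{R}^{m\times n}$, $C\in\mathbb{R}^{p\times n}$, $b\in\mathbb{R}^m$, $d\in\mathbb{R}^p$. The minimum 2-norm solution of $$\min_{x\in\mathcal S}\|Ax-b\|_2,\qquad \mathcal S=\{x\in\mathbb{R}^n:\ \|Cx-d\|_2=\min\}$$ has the form $$x^\dagger = C^\dagger d+A_{\mathcal N(C)}^\dagger\bigl(b-AC^\dagger d\bigr).$$
   Context: $\mathcal N(C)$ is the null space of $C$; $C^\dagger$ is the Moore–Penrose pseudoinverse. The set $\mathcal S$ is the set of all minimizers of $x\mapsto\|Cx-d\|_2$ over $\mathbb{R}^n$. Let $\mathcal A:(\mathcal N(C),\langle\cdot,\cdot\rangle_2)\to(\mathbb{R}^m,\langle\cdot,\cdot\rangle_2)$, $v\mapsto Av$. Then $A_{\mathcal N(C)}^\dagger\in\mathbb{R}^{n\times m}$ denotes the matrix (in the canonical bases of $\mathbb{R}^n$ and $\mathbb{R}^m$) of the Moore–Penrose inverse $\mathcal A^\dagger$ of $\mathcal A$; that is, for every $y\in\mathbb{R}^m$, $A_{\mathcal N(C)}^\dagger y$ is the minimum 2-norm solution of $\min_{x\in\mathcal N(C)}\|Ax-y\|_2$. The minimum 2-norm solution of a problem is its solution of smallest Euclidean norm. *)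

(* Defs.v *)
From mathcomp Require Import all_boot all_order all_algebra.
From mathcomp Require Import boolp classical_sets reals.

Set Implicit Arguments.
Unset Strict Implicit.
Unset Printing Implicit Defensive.

Import Order.TTheory GRing.Theory Num.Theory.
Local Open Scope ring_scope.
Local Open Scope classical_set_scope.

(* Vectors are columns. *)

Definition dotv (R : realType) (n : nat) (u v : 'cV[R]_n) : R :=
  \sum_(i < n) u i 0 * v i 0.

Definition norm2 (R : realType) (n : nat) (x : 'cV[R]_n) : R :=
  Num.sqrt (dotv x x).

Definition minimizers (R : realType) (T : Type) (D : set T) (f : T -> R) :
    set T :=
  [set x | D x /\ forall y, D y -> f x <= f y].

Definition null_space (R : realType) (p n : nat) (C : 'M[R]_(p, n)) :
    set 'cV[R]_n :=
  [set x | C *m x = 0].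

Definition is_mpinv (R : realType) (m n : nat)
    (A : 'M[R]_(m, n)) (X : 'M[R]_(n, m)) : Prop :=
  [/\ A *m X *m A = A,
      X *m A *m X = X,
      (A *m X)^T = A *m X &
      (X *m A)^T = X *m A].

(* X is the matrix of the Moore-Penrose inverse of the linear operator
   v |-> A v from the subspace D (with the inner product of R^n) to R^m: X maps
   R^m into D, and the four Penrose equations hold, with the adjoints taken
   with respect to the inner products of D and R^m. *)
Definition is_mpinv_on (R : realType) (m n : nat) (D : set 'cV[R]_n)
    (A : 'M[R]_(m, n)) (X : 'M[R]_(n, m)) : Prop :=
  (forall y, D (X *m y)) /\
  [/\ forall v, D v -> A *m (X *m (A *m v)) = A *m v,
      forall y : 'cV_m, X *m (A *m (X *m y)) = X *m y,
      forall y z, dotv (A *m (X *m y)) z = dotv y (A *m (X *m z)) &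
      forall u v, D u -> D v ->
        dotv (X *m (A *m u)) v = dotv u (X *m (A *m v))].

(* The default value 0 of xget is never used: see mpinvP and
   mpinv_null_spaceP below. *)
Definition mpinv (R : realType) (m n : nat) (A : 'M[R]_(m, n)) :
    'M[R]_(n, m) :=
  xget 0 [set X | is_mpinv A X].

Definition mpinv_null_space (R : realType) (m n p : nat)
    (A : 'M[R]_(m, n)) (C : 'M[R]_(p, n)) : 'M[R]_(n, m) :=
  xget 0 [set X | is_mpinv_on (null_space C) A X].

Lemma dotvE (R : realType) n (u v : 'cV[R]_n) : dotv u v = (u^T *m v) 0 0.
Proof. by rewrite mxE; apply: eq_bigr => i _; rewrite mxE. Qed.

Lemma mulmx_tr_eq0 (R : realType) m n (B : 'M[R]_(m, n)) :
  B *m B^T = 0 -> B = 0.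
Proof.
move=> BB0; apply/matrixP => i j; move/matrixP/(_ i i): BB0; rewrite !mxE.
move=> /eqP; rewrite psumr_eq0 => [/allP/(_ j (mem_index_enum _))|k _].
  by rewrite mxE -expr2 sqrf_eq0 => /eqP.
by rewrite mxE -expr2 sqr_ge0.
Qed.

Lemma gram_unit (R : realType) m n (B : 'M[R]_(m, n)) :
  row_free B -> B *m B^T \in unitmx.
Proof.
move=> Bfree; rewrite -row_free_unit -kermx_eq0; apply/eqP.
have /mulmx_tr_eq0 : (kermx (B *m B^T) *m B) *m (kermx (B *m B^T) *m B)^T = 0.
  by rewrite trmx_mul mulmxA -(mulmxA _ B) mulmx_ker mul0mx.
by move/eqP; rewrite mulmx_free_eq0 // => /eqP.
Qed.

Lemma is_mpinv_ex (R : realType) m n (A : 'M[R]_(m, n)) :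
  exists X, is_mpinv A X.
Proof.
suff full r (L : 'M[R]_(m, r)) (B : 'M[R]_(r, n)) :
    row_full L -> row_free B -> exists X, is_mpinv (L *m B) X.
  have := full _ _ _ (col_base_full A) (row_base_free A).
  by rewrite mulmx_base.
move=> fullL freeB {A}; set A := L *m B; have AE : A = L *m B by [].
have UB : B *m B^T \in unitmx by exact: gram_unit.
have UL : L^T *m L \in unitmx.
  rewrite -{2}[L]trmxK; apply: gram_unit.
  by rewrite /row_free mxrank_tr.
pose G := invmx (B *m B^T); pose H := invmx (L^T *m L).
have GT : G^T = G by rewrite /G trmx_inv trmx_mul trmxK.
have HT : H^T = H by rewrite /H trmx_inv trmx_mul trmxK.
pose X := B^T *m G *m H *m L^T.
have AX : A *m X = L *m H *m L^T.
  by rewrite AE /X !mulmxA -(mulmxA L B) -(mulmxA L _ G) mulmxV // mulmx1.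
have XA : X *m A = B^T *m G *m B.
  rewrite AE /X !mulmxA -(mulmxA _ L^T L) -(mulmxA _ H) mulVmx //.
  by rewrite mulmx1.
exists X; split.
- rewrite AX {1}AE !mulmxA -(mulmxA _ L^T L) -(mulmxA L H) mulVmx //.
  by rewrite mulmx1 -AE.
- rewrite XA /X !mulmxA -(mulmxA _ B B^T) -(mulmxA B^T G) mulVmx //.
  by rewrite mulmx1.
- by rewrite AX !trmx_mul trmxK HT mulmxA.
- by rewrite XA !trmx_mul trmxK GT mulmxA.
Qed.

Lemma is_mpinv_uniq (R : realType) m n (A : 'M[R]_(m, n)) X Y :
  is_mpinv A X -> is_mpinv A Y -> X = Y.
Proof.
move=> [X1 X2 X3 X4] [Y1 Y2 Y3 Y4].
have AXY : A *m X = A *m Y.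
  by rewrite -X3 -[in LHS]Y1 -(mulmxA (A *m Y)) trmx_mul X3 Y3 mulmxA X1.
have XYA : X *m A = Y *m A.
  rewrite -X4 -[in LHS]Y1 -(mulmxA A) mulmxA trmx_mul Y4 X4.
  by rewrite -mulmxA (mulmxA A) X1.
by rewrite -X2 XYA -mulmxA AXY mulmxA Y2.
Qed.

Lemma mpinvP (R : realType) m n (A : 'M[R]_(m, n)) X :
  is_mpinv A X <-> X = mpinv A.
Proof.
have mpA : is_mpinv A (mpinv A) by apply: xgetPex; exact: is_mpinv_ex.
by split=> [mpX | ->//]; exact: is_mpinv_uniq mpX mpA.
Qed.

Lemma dotv_mulmx (R : realType) m n (A : 'M[R]_(m, n)) u v :
  dotv (A *m u) v = dotv u (A^T *m v).
Proof. by rewrite !dotvE trmx_mul mulmxA. Qed.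

Lemma mulmx_ext (R : realType) m n (Y Z : 'M[R]_(m, n)) :
  (forall v : 'cV_n, Y *m v = Z *m v) -> Y = Z.
Proof.
move=> YZ; apply/matrixP => i j.
by have /matrixP/(_ i 0) := YZ (delta_mx j 0); rewrite -!colE !mxE.
Qed.

Lemma dotv_sym (R : realType) n (S : 'M[R]_n) :
  (forall u v, dotv (S *m u) v = dotv u (S *m v)) -> S^T = S.
Proof.
move=> symS; apply/matrixP => i j.
have := symS (delta_mx i 0) (delta_mx j 0).
rewrite dotv_mulmx !dotvE !mulmxA trmx_delta -!rowE -!colE.
by rewrite !mxE.
Qed.

(* The Moore-Penrose inverse of A on the null space of C is that of A P, where
   P is the orthogonal projector onto this null space. *)
Lemma is_mpinv_onE (R : realType) m n p (A : 'M[R]_(m, n)) (C : 'M[R]_(p, n))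
    X :
  is_mpinv_on (null_space C) A X <->
  is_mpinv (A *m (1%:M - mpinv C *m C)) X.
Proof.
have [C1 C2 C3 C4] : is_mpinv C (mpinv C) by apply/mpinvP.
set P := 1%:M - _.
have PT : P^T = P by rewrite /P linearB /= trmx1 C4.
have CP : C *m P = 0 by rewrite mulmxBr mulmx1 mulmxA C1 subrr.
have PD k (Y : 'M_(n, k)) : C *m Y = 0 -> P *m Y = Y.
  by move=> CY; rewrite mulmxBl mul1mx -mulmxA CY mulmx0 subr0.
have DP v : null_space C (P *m v) by rewrite /null_space /= mulmxA CP mul0mx.
split.
- move=> [XD [X1 X2 X3 X4]].
  have CX : C *m X = 0.
    by apply: mulmx_ext => v; rewrite mul0mx -mulmxA; exact: XD.
  have QX : A *m P *m X = A *m X by rewrite -mulmxA PD.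
  split; rewrite ?QX.
  + by apply: mulmx_ext => v; rewrite -!mulmxA X1.
  + by rewrite -mulmxA QX; apply: mulmx_ext => v; rewrite -!mulmxA X2.
  + by apply: dotv_sym => u v; rewrite -!mulmxA X3.
  + apply: dotv_sym => u v; rewrite -!mulmxA.
    rewrite -[X *m _](PD) ?mulmxA ?CX ?mul0mx // -!mulmxA.
    rewrite dotv_mulmx PT X4 //.
    by rewrite -{1}PT dotv_mulmx trmxK PD // XD.
- move=> [Q1 Q2 Q3 Q4].
  have CX : C *m X = 0.
    by rewrite -Q2 -Q4 !trmx_mul PT !mulmxA CP !mul0mx.
  have QX : A *m P *m X = A *m X by rewrite -mulmxA PD.
  rewrite QX in Q1 Q3.
  split; first by move=> y; rewrite /null_space /= mulmxA CX mul0mx.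
  split.
  + move=> v Dv; rewrite -[in LHS](PD _ v Dv) -[in RHS](PD _ v Dv).
    by rewrite [in RHS]mulmxA -[in RHS]Q1 !mulmxA.
  + by move=> y; rewrite -[in RHS]Q2 -(mulmxA X) QX !mulmxA.
  + by move=> y z; rewrite !mulmxA dotv_mulmx Q3.
  + move=> u v Du Dv; rewrite -[in LHS](PD _ u Du) -[in RHS](PD _ v Dv).
    rewrite (mulmxA A P u) (mulmxA A P v) 2!(mulmxA X (A *m P)).
    by rewrite dotv_mulmx Q4.
Qed.

Lemma mpinv_null_spaceP (R : realType) m n p (A : 'M[R]_(m, n))
    (C : 'M[R]_(p, n)) X :
  is_mpinv_on (null_space C) A X <-> X = mpinv_null_space A C.
Proof.
have mpAC : is_mpinv_on (null_space C) A (mpinv_null_space A C).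
  apply: xgetPex; have [Y mpY] := is_mpinv_ex (A *m (1%:M - mpinv C *m C)).
  by exists Y; apply/is_mpinv_onE.
split=> [|->//] /is_mpinv_onE mpX.
by move/is_mpinv_onE: mpAC; exact: is_mpinv_uniq.
Qed.

(* Main.v *)
(* Each of the three nested problems minimizes some |M x - c| over an affine
   set, and x^dagger solves all three: the residual M x^dagger - c is orthogonal
   to M (x - x^dagger) for every feasible x.  By Pythagoras the minimizers are
   then the feasible x with M x = M x^dagger.  For the last problem M is the
   identity, so x^dagger is the only one. *)
Require Import Defs.
From mathcomp Require Import all_boot all_order all_algebra.
From mathcomp Require Import boolp classical_sets reals.
Import Order.TTheory GRing.Theory Num.Theory.
Local Open Scope ring_scope.
Local Open Scope classical_set_scope.

Section DotProduct.
Context {R : realType}.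

Lemma dotvC {n} (u v : 'cV[R]_n) : dotv u v = dotv v u.
Proof. by apply: eq_bigr => i _; rewrite mulrC. Qed.

Lemma dotvDr {n} (u v w : 'cV[R]_n) : dotv u (v + w) = dotv u v + dotv u w.
Proof. by rewrite !dotvE mulmxDr mxE. Qed.

Lemma dotvBr {n} (u v w : 'cV[R]_n) : dotv u (v - w) = dotv u v - dotv u w.
Proof. by rewrite !dotvE mulmxBr !mxE. Qed.

Lemma dotv0l {n} (u : 'cV[R]_n) : dotv 0 u = 0.
Proof. by rewrite dotvE trmx0 mul0mx mxE. Qed.

Lemma dotv_ge0 {n} (u : 'cV[R]_n) : 0 <= dotv u u.
Proof. by apply: sumr_ge0 => i _; rewrite -expr2 sqr_ge0. Qed.

Lemma dotv_eq0 {n} (u : 'cV[R]_n) : dotv u u = 0 -> u = 0.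
Proof.
rewrite dotvE => uu0; apply: trmx_inj; rewrite trmx0; apply: mulmx_tr_eq0.
by rewrite trmxK [LHS]mx11_scalar uu0 raddf0.
Qed.

Lemma ler_norm2 {n} (u v : 'cV[R]_n) :
  (norm2 u <= norm2 v) = (dotv u u <= dotv v v).
Proof. by rewrite /norm2 ler_sqrt // dotv_ge0. Qed.

Lemma dotv_pythagoras {n} (u v : 'cV[R]_n) :
  dotv u v = 0 -> dotv (u + v) (u + v) = dotv u u + dotv v v.
Proof.
move=> uv0; rewrite dotvDr !(dotvC (u + v)) !dotvDr (dotvC v u) uv0.
by rewrite addr0 add0r.
Qed.

(** On [D], the squared residual is [|M (x - x0)|^2] plus the constant [|M x0 - c|^2], so it is
    least exactly where the first term vanishes. *)
Lemma minimizers_orthogonal_residual {k n} (D : set 'cV[R]_n)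
    (M : 'M[R]_(k, n)) (c : 'cV[R]_k) (x0 : 'cV[R]_n) :
  D x0 ->
  (forall x, D x -> dotv (M *m (x - x0)) (M *m x0 - c) = 0) ->
  minimizers D (fun x => norm2 (M *m x - c)) =
  [set x | D x /\ M *m x = M *m x0].
Proof.
move=> Dx0 orth.
have sqE x : D x -> dotv (M *m x - c) (M *m x - c) =
    dotv (M *m (x - x0)) (M *m (x - x0)) + dotv (M *m x0 - c) (M *m x0 - c).
  move=> Dx; rewrite -dotv_pythagoras ?orth //.
  by rewrite mulmxBr addrA subrK.
apply/seteqP; split => x /= [Dx xP]; split=> //.
  have := xP _ Dx0; rewrite ler_norm2 sqE // gerDr => le0.
  apply/eqP; rewrite -subr_eq0 -mulmxBr; apply/eqP/dotv_eq0.
  by apply/eqP; rewrite eq_le le0 dotv_ge0.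
by move=> y Dy; rewrite xP ler_norm2 (sqE y Dy) lerDr dotv_ge0.
Qed.

End DotProduct.

Theorem corollary3p1 (R : realType) (m n p : nat)
    (A : 'M[R]_(m, n)) (C : 'M[R]_(p, n)) (b : 'cV[R]_m) (d : 'cV[R]_p) :
  let S : set 'cV[R]_n := minimizers setT (fun x => norm2 (C *m x - d)) in
  minimizers (minimizers S (fun x => norm2 (A *m x - b))) (@norm2 R n) =
  [set mpinv C *m d + mpinv_null_space A C *m (b - A *m mpinv C *m d)].
Proof.
move=> S.
have [C1 C2 C3 C4] : is_mpinv C (mpinv C) by apply/mpinvP.
have [XN [X1 X2 X3 X4]] :
  is_mpinv_on (null_space C) A (mpinv_null_space A C) by apply/mpinv_null_spaceP.
set X := mpinv_null_space A C in XN X1 X2 X3 X4 *.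
set r := b - _; set x0 := _ + _.
have CX (y : 'cV_m) : C *m (X *m y) = 0 by exact: XN.
have Cx0 : C *m x0 = C *m (mpinv C *m d) by rewrite mulmxDr CX addr0.
have SE : S = [set x | C *m x = C *m x0].
  rewrite /S (minimizers_orthogonal_residual _ _ _ x0) //.
    by apply/seteqP; split=> x; [case|].
  (* Normal equations: with [Y = mpinv C], symmetry of [C Y] gives [C^T C Y = (C Y C)^T = C^T]. *)
  move=> x _; rewrite Cx0 dotv_mulmx mulmxBr !mulmxA -(mulmxA C^T) -C3.
  by rewrite -trmx_mul C1 subrr dotvC dotv0l.
have Sx0 : S x0 by rewrite SE.
have SN x : S x -> null_space C (x - x0).
  by rewrite SE /null_space /= mulmxBr => ->; rewrite subrr.
rewrite (minimizers_orthogonal_residual _ _ _ x0) //; last first.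
  (* For [u = x - x0] in the null space, self-adjointness of [A X] turns [dotv (A u) (A X r)] into
     [dotv (A X A u) r = dotv (A u) r]. *)
  move=> x /SN Nu.
  have -> : A *m x0 - b = A *m (X *m r) - r.
    by rewrite mulmxDr /r opprB mulmxA addrCA addrA.
  by rewrite dotvBr -X3 X1 // subrr.
(* The norm is the residual for the identity matrix and target 0, so the same lemma applies a third
   time. *)
have -> : @norm2 R n = fun x => norm2 (1%:M *m x - 0).
  by apply: funext => x; rewrite mul1mx subr0.
rewrite (minimizers_orthogonal_residual _ _ _ x0) //.
  apply/seteqP; split => x /=; first by case=> _; rewrite !mul1mx.
  by move=> ->.
move=> x [/SN Nu Ax]; rewrite !mul1mx subr0.
have Au : A *m (x - x0) = 0 by rewrite mulmxBr Ax subrr.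
(* The range of [mpinv C] lies in that of [C^T], hence is orthogonal to the null space of [C]. *)
rewrite dotvDr -C2 -C4 trmx_mul -!mulmxA -dotv_mulmx Nu dotv0l add0r.
(* Writing [X r = X A X r] and moving the self-adjoint [X A] to the left makes [A (x - x0) = 0]
   appear. *)
by rewrite -X2 -X4 // Au mulmx0 dotv0l.
Qed.
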